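(* Setting $s=qx$, $p=x$ and all other parameters ($a,b,c,d,f,g,h,\ell,r,t,u,w$) equal to $1$ in $\mathcal C$, one obtains $$\mathcal C(z)=\sum_{n\ge0}\sum_{\sigma\in\mathcal S_n}x^{\mathsf{des}(\sigma)}q^{\mathsf{occ}_{321}(\sigma)}z^n,$$ where $\mathsf{occ}_{321}(\sigma)$ is the number of occurrences of the consecutive pattern $321$ in $\sigma$ and $\mathsf{des}(\sigma)$ is the number of descents of $\sigma$.
   Context: $\mathcal S_n$ is the set of permutations of $[n]=\{1,\dots,n\}$. A descent of $\sigma\in\mathcal S_n$ is an $i\in[n-1]$ with $\sigma(i)>\sigma(i+1)$. An occurrence of the consecutive pattern $321$ is an index $i$ with $1\le i\le n-2$ and $\sigma(i)>\sigma(i+1)>\sigma(i+2)$. For $n\ge1$, $[n]_{x,y}:=\sum_{i=0}^{n-1}x^{n-1-i}y^{i}$, and $[0]_{x,y}:=0$. For parameters $a,b,c,d,f,g,h,\ell,p,r,s,t,u,w$, $\mathcal C(z)$ is the formal power series in $z$ defined by the continued fraction $$\mathcal C(z)=\cfrac{1}{1-\alpha_0z-\cfrac{\beta_1z^2}{1-\alpha_1z-\cfrac{\beta_2z^2}{\ddots}}},\qquad \alpha_n=u\,w^n+s\,[n]_{a,b}+t\,[n]_{f,g}\ (n\ge 0),\quad \beta_n=p\,r\,[n]_{c,d}\,[n]_{h,\ell}\ (n\ge 1).$$ *)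

(* Defs.v *)
From mathcomp Require Import all_boot all_order all_algebra.
From mathcomp Require Import perm.

Set Implicit Arguments.
Unset Strict Implicit.
Unset Printing Implicit Defensive.

Import GRing.Theory.
Local Open Scope ring_scope.

(* A formal power series in z is its sequence of coefficients: F k is the
   coefficient of z^k. *)
Definition fps (R : comNzRingType) := nat -> R.

Definition fps_one (R : comNzRingType) : fps R := fun k => (k == 0%N)%:R.

Definition fps_mul (R : comNzRingType) (F G : fps R) : fps R :=
  fun k => \sum_(i < k.+1) F (k - i)%N * G i.

(* The first n coefficients of 1/F, for F with constant coefficient 1, obtained
   by solving F * G = 1 degree by degree. *)
Fixpoint fps_inv_seq (R : comNzRingType) (F : fps R) (n : nat) : seq R :=
  if n is m.+1 then
    let G := fps_inv_seq F m in
    rcons G ((m == 0%N)%:R - \sum_(i < m) F (m - i)%N * G`_i)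
  else [::].

Definition fps_inv (R : comNzRingType) (F : fps R) : fps R :=
  fun k => (fps_inv_seq F k.+1)`_k.

(* The series 1 - a z - b z^2 F(z). *)
Definition jden (R : comNzRingType) (a b : R) (F : fps R) : fps R :=
  fun k => match k with 0 => 1 | 1 => - a | j.+2 => - (b * F j) end.

(* The finite continued fraction
     1/(1 - al_n z - be_{n+1} z^2/(1 - al_{n+1} z - ... /(1 - al_{n+m} z))),
   which starts at level n and ends at level n + m. *)
Fixpoint jtrunc (R : comNzRingType) (al be : nat -> R) (m n : nat) : fps R :=
  if m is m'.+1 then fps_inv (jden (al n) (be n.+1) (jtrunc al be m' n.+1))
  else fps_inv (jden (al n) 0 (@fps_one R)).

(* The infinite continued fraction, as the coefficientwise limit of its
   truncations; by [jfrac_limit] below, the coefficient of z^k is the same in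
   all the truncations at level m >= k. *)
Definition jfrac (R : comNzRingType) (al be : nat -> R) : fps R :=
  fun k => jtrunc al be k 0 k.

(* [n]_{x,y}, the sum of the monomials of degree n - 1 in x and y. *)
Definition qint (R : comNzRingType) (n : nat) (x y : R) : R :=
  \sum_(i < n) x ^+ (n.-1 - i) * y ^+ i.

Record jparams (R : comNzRingType) := JParams {
  par_a : R; par_b : R; par_c : R; par_d : R; par_f : R; par_g : R; par_h : R;
  par_l : R; par_p : R; par_r : R; par_s : R; par_t : R; par_u : R; par_w : R
}.

Definition calC (R : comNzRingType) (P : jparams R) : fps R :=
  let: JParams a b c d f g h l p r s t u w := P in
  jfrac (fun n => u * w ^+ n + s * qint n a b + t * qint n f g)
        (fun n => p * r * qint n c d * qint n h l).

(* Positions and values are numbered from 0: [oneline sigma] is the word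
   sigma(1) ... sigma(n) with all the values decreased by 1. *)
Definition oneline (n : nat) (sigma : 'S_n) : seq nat :=
  [seq val (sigma i) | i <- enum 'I_n].

Definition des (n : nat) (sigma : 'S_n) : nat :=
  let v := nth 0%N (oneline sigma) in
  #|[set i : 'I_n.-1 | (v i > v i.+1)%N]|.

Definition occ321 (n : nat) (sigma : 'S_n) : nat :=
  let v := nth 0%N (oneline sigma) in
  #|[set i : 'I_n.-2 | (v i > v i.+1)%N && (v i.+1 > v i.+2)%N]|.

Lemma size_fps_inv_seq (R : comNzRingType) (F : fps R) n :
  size (fps_inv_seq F n) = n.
Proof. by elim: n => //= n IHn; rewrite size_rcons IHn. Qed.

Lemma nth_fps_inv_seq (R : comNzRingType) (F : fps R) n i :
  (i < n)%N -> (fps_inv_seq F n)`_i = fps_inv F i.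
Proof.
elim: n => // n IHn; rewrite ltnS leq_eqVlt => /predU1P[-> //|lt_in].
by rewrite /= nth_rcons size_fps_inv_seq lt_in IHn.
Qed.

Lemma fps_invE (R : comNzRingType) (F : fps R) k :
  fps_inv F k = (k == 0%N)%:R - \sum_(i < k) F (k - i)%N * fps_inv F i.
Proof.
rewrite {1}/fps_inv /= nth_rcons size_fps_inv_seq ltnn eqxx.
by congr (_ - _); apply: eq_bigr => i _; rewrite nth_fps_inv_seq.
Qed.

Lemma fps_mulV (R : comNzRingType) (F : fps R) :
  F 0%N = 1 -> fps_mul F (fps_inv F) =1 @fps_one R.
Proof.
move=> F0 k; rewrite /fps_mul big_ord_recr /= subnn F0 mul1r fps_invE.
by rewrite addrC subrK.
Qed.

Lemma eq_fps_inv (R : comNzRingType) (F G : fps R) k :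
  (forall j, (j <= k)%N -> F j = G j) -> fps_inv F k = fps_inv G k.
Proof.
elim/ltn_ind: k => k IHk FG; rewrite !fps_invE; congr (_ - _).
apply: eq_bigr => i _; rewrite FG ?leq_subr // IHk // => j le_ji.
by apply: FG; apply: leq_trans le_ji (ltnW _).
Qed.

Lemma jtrunc_stable (R : comNzRingType) (al be : nat -> R) m m' n k :
  (k <= m)%N -> (k <= m')%N -> jtrunc al be m n k = jtrunc al be m' n k.
Proof.
elim: m m' n k => [|m IHm] [|m'] n k //=.
- by move=> + _; rewrite leqn0 => /eqP->; apply: eq_fps_inv => -[].
- by move=> _; rewrite leqn0 => /eqP->; apply: eq_fps_inv => -[].
move=> km km'; apply: eq_fps_inv => -[|[|j]] //= jk; congr (- (_ * _)).
by apply: IHm; rewrite -ltnS; [apply: leq_trans km|apply: leq_trans km']; apply: ltnW.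
Qed.

Lemma jfrac_limit (R : comNzRingType) (al be : nat -> R) m k :
  (k <= m)%N -> jtrunc al be m 0 k = jfrac al be k.
Proof. by move=> km; apply: jtrunc_stable. Qed.

(* Main.v *)
Require Import Defs.
From mathcomp Require Import all_boot all_order all_algebra.
From mathcomp Require Import perm.
From mathcomp Require Import ring.

(* Build a permutation by inserting its values in increasing order. Put an
   infinite letter to the right of the word, and call T_k(n) the weighted number
   of ways to distribute n values over k + 1 words, the last k of which are
   nonempty and lie between two infinite letters. The largest value is alone
   between infinite letters (a valley), at the left or right end of a word (a
   double descent or a double ascent), or in the interior of a word or at the
   left end of the first one (a peak, which cuts the word into two), so that
     T_k(n+1) = k T_{k-1}(n) + (1 + k (1 + q x)) T_k(n) + x (k+1) T_{k+1}(n).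
   This tridiagonal recurrence is the one of the continued fraction. *)

Set Implicit Arguments.
Unset Strict Implicit.
Unset Printing Implicit Defensive.

Import GRing.Theory.
Local Open Scope ring_scope.

(** * Ring laws of formal power series *)

Section Series.
Variable R : comNzRingType.
Implicit Types F G H : fps R.

(** Transfers ring laws from [{poly R}]: coefficient k of a product involves only coefficients up to
    k. *)
Lemma coef_fps_mul F G N k : (k < N)%N ->
  (\poly_(i < N) F i * \poly_(i < N) G i)`_k = fps_mul F G k.
Proof.
move=> ltkN; rewrite coefMr; apply: eq_bigr => i _.
have le_ik : (i <= k)%N by rewrite -ltnS.
by rewrite !coef_poly (leq_ltn_trans (leq_subr _ _)) // (leq_ltn_trans le_ik).
Qed.

Lemma fps_mulC F G : fps_mul F G =1 fps_mul G F.
Proof. by move=> k; rewrite -!(coef_fps_mul _ _ (ltnSn k)) mulrC. Qed.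

Lemma eq_fps_mulr F G G' : G =1 G' -> fps_mul F G =1 fps_mul F G'.
Proof. by move=> eqG k; apply: eq_bigr => i _; rewrite eqG. Qed.

Lemma fps_mulA F G H : fps_mul F (fps_mul G H) =1 fps_mul (fps_mul F G) H.
Proof.
move=> k; pose p A : {poly R} := \poly_(i < k.+1) A i.
have pM A B i : (i < k.+1)%N -> (p (fps_mul A B))`_i = (p A * p B)`_i.
  by move=> lti; rewrite coef_poly lti coef_fps_mul.
rewrite -!(coef_fps_mul _ _ (ltnSn k)) -/(p _) -/(p H).
(* Truncating the inner product changes only degrees above k, out of reach of coefficient k. *)
have -> : (p F * p (fps_mul G H))`_k = (p F * (p G * p H))`_k.
  by rewrite !coefMr; apply: eq_bigr => i _; rewrite pM.
have -> : (p (fps_mul F G) * p H)`_k = (p F * p G * p H)`_k.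
  by rewrite !coefM; apply: eq_bigr => i _; rewrite pM.
by rewrite mulrA.
Qed.

Lemma fps_mulr1 F : fps_mul F (@fps_one R) =1 F.
Proof.
move=> k; rewrite /fps_mul big_ord_recl /= subn0 mulr1 big1 ?addr0 // => i _.
by rewrite /fps_one /= mulr0.
Qed.

Definition fps_shift F : fps R := fun k => if k is j.+1 then F j else 0.

Lemma fps_mul_shift F G : fps_mul F (fps_shift G) =1 fps_shift (fps_mul F G).
Proof.
by case=> [|k]; rewrite /fps_mul big_ord_recl /= mulr0 add0r ?big_ord0.
Qed.

Lemma fps_mulDr F G H :
  fps_mul F (fun k => G k + H k) =1 fun k => fps_mul F G k + fps_mul F H k.
Proof.
by move=> k; rewrite -big_split; apply: eq_bigr => i _; rewrite mulrDr.
Qed.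

Lemma fps_mulZr a F G :
  fps_mul F (fun k => a * G k) =1 fun k => a * fps_mul F G k.
Proof.
by move=> k; rewrite mulr_sumr; apply: eq_bigr => i _; rewrite mulrCA.
Qed.

Lemma eq_fps_shift F G : F =1 G -> fps_shift F =1 fps_shift G.
Proof. by move=> eqF [|k] /=. Qed.

End Series.

(** * Continued fractions and tridiagonal recurrences *)

Section Tridiagonal.
Variables (R : comNzRingType) (al be : nat -> R).

Definition jtail n : fps R := fun k => jtrunc al be k n k.

(** This is J_n (1 - al_n z - be_{n+1} z^2 J_{n+1}) = 1, solved for the leading J_n. *)
Lemma jtailE n : jtail n =1 fun k => @fps_one R k
  + fps_shift (fun j => al n * jtail n j
       + be n.+1 * fps_shift (fps_mul (jtail n.+1) (jtail n)) j) k.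
Proof.
move=> k; rewrite /jtail (@jtrunc_stable _ _ _ k k.+1) //= fps_invE.
have tailE i : (i <= k)%N ->
    fps_inv (jden (al n) (be n.+1) (jtrunc al be k n.+1)) i = jtail n i.
  by move=> le_ik; rewrite /jtail (@jtrunc_stable _ _ _ i k.+1) // ltnW.
congr (_ + _); case: k tailE => [|k] tailE; first by rewrite big_ord0 oppr0.
(* The last summand carries the degree 1 coefficient of [jden], hence the [al] term; the others
   carry degrees at least 2, hence the [be] term. *)
rewrite big_ord_recr /= subSnn tailE // /= mulNr opprD opprK addrC.
congr (_ + _); case: k tailE => [|k] tailE.
  by rewrite big_ord0 mulr0 oppr0.
rewrite /fps_mul /= mulr_sumr -sumrN; apply: eq_bigr => i _.
have le_ik : (i <= k)%N by rewrite -ltnS.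
rewrite tailE; last by rewrite !leqW.
rewrite subSn ?subSn ?leqW //= mulNr opprK mulrA; congr (_ * _ * _).
rewrite -[LHS]/(jtrunc al be k.+2 n.+1 (k - i)%N); apply: jtrunc_stable => //.
by rewrite (leq_trans (leq_subr _ _)) // !leqW.
Qed.

Lemma mul_jtail P n : fps_mul P (jtail n) =1 fun k => P k
  + fps_shift (fun j => al n * fps_mul P (jtail n) j
       + be n.+1 * fps_shift (fps_mul (fps_mul P (jtail n)) (jtail n.+1)) j) k.
Proof.
move=> k; rewrite (eq_fps_mulr _ (jtailE n)) fps_mulDr fps_mulr1; congr (_ + _).
rewrite fps_mul_shift; apply: eq_fps_shift => {}k; rewrite fps_mulDr !fps_mulZr.
congr (_ + _ * _); rewrite fps_mul_shift; apply: eq_fps_shift => {}k.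
by rewrite (eq_fps_mulr _ (fps_mulC _ _)) fps_mulA.
Qed.

(* c_0 ... c_{k-1} z^k J_0 ... J_k, where J_j is the tail of the continued
   fraction at level j; these series solve the tridiagonal recurrence. *)
Fixpoint jcolumn (c : nat -> R) k : fps R :=
  if k is j.+1 then
    fun n => c j * fps_shift (fps_mul (jcolumn c j) (jtail k)) n
  else jtail 0.

(** [K k n] weighs the Motzkin paths of n steps from height 0 to height k, with weight [c k] for a
    rise from k, [b k] for a fall to k and [al k] for a level step at k. The coefficients of
    [jcolumn c k] obey the same recurrence with the same initial values. *)
Lemma jfrac_tridiagonal (b c : nat -> R) (K : nat -> nat -> R) :
  (forall k, be k.+1 = b k * c k) ->
  (forall k, K k 0%N = (k == 0%N)%:R) ->
  (forall n, K 0%N n.+1 = al 0 * K 0%N n + b 0%N * K 1%N n) ->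
  (forall k n, K k.+1 n.+1 =
     c k * K k n + al k.+1 * K k.+1 n + b k.+1 * K k.+2 n) ->
  jfrac al be =1 K 0%N.
Proof.
move=> beE K0 K0S KSS.
suff colE n k : jcolumn c k n = K k n by move=> n; rewrite -colE.
elim: n k => [|n IHn] [|k]; rewrite ?K0 ?K0S ?KSS -?IHn /=.
- by rewrite jtailE /= addr0.
- by rewrite mulr0.
- rewrite jtailE /= add0r beE mulrA; congr (_ + _ * _).
  by case: n {IHn} => //= n; apply: fps_mulC.
rewrite mul_jtail mulrDr beE -addrA; congr (_ + _); case: n {IHn} => [|n] /=.
  by rewrite !mulr0 addr0.
rewrite mulrDr mulrCA; congr (_ + _).
rewrite mulrCA -!mulrA; congr (_ * (_ * _)).
rewrite [RHS]fps_mulC fps_mulZr; congr (_ * _).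
by rewrite fps_mul_shift; apply: eq_fps_shift; apply: fps_mulC.
Qed.

End Tridiagonal.

(** * Sums over cuts and rearrangements of words *)

Section Deconcatenation.
Variables (R : comNzRingType) (T : Type).
Implicit Types (phi psi : seq T -> seq T -> R) (f g : seq T -> R).
Implicit Types (u v w l : seq T) (a c : R) (P : pred T).

Fixpoint cuts phi w : R :=
  if w is x :: w' then phi [::] w + cuts (fun u v => phi (x :: u) v) w'
  else phi [::] [::].

Lemma eq_cuts phi psi w :
  (forall u v, u ++ v = w -> phi u v = psi u v) -> cuts phi w = cuts psi w.
Proof.
elim: w phi psi => [|x w IHw] phi psi eq_phi /=; first exact: eq_phi.
rewrite eq_phi //; congr (_ + _); apply: IHw => u v eq_w.
by apply: eq_phi; rewrite /= eq_w.
Qed.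

Lemma cutsD phi psi w :
  cuts (fun u v => phi u v + psi u v) w = cuts phi w + cuts psi w.
Proof. by elim: w phi psi => //= x w IHw phi psi; rewrite IHw addrACA. Qed.

Lemma cutsZ a phi w : cuts (fun u v => a * phi u v) w = a * cuts phi w.
Proof. by elim: w phi => //= x w IHw phi; rewrite IHw mulrDr. Qed.

Lemma cuts_catl phi x u v :
  cuts phi (u ++ x :: v) =
    cuts (fun u1 u2 => phi u1 (u2 ++ x :: v)) u
    + cuts (fun v1 v2 => phi (u ++ x :: v1) v2) v.
Proof. by elim: u phi => //= y u IHu phi; rewrite IHu addrA. Qed.

(** Coassociativity: both sides range over the factorizations of w into three words. *)
Lemma cutsA (chi : seq T -> seq T -> seq T -> R) w :
  cuts (fun u v => cuts (fun u1 u2 => chi u1 u2 v) u) w =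
  cuts (fun u1 v' => cuts (fun u2 v => chi u1 u2 v) v') w.
Proof.
elim: w chi => //= x w IHw chi; rewrite cutsD IHw addrA; congr (_ + _).
Qed.

Definition insert x f w := cuts (fun u v => f (u ++ x :: v)) w.

(** A cut made after inserting x leaves x in the left factor or in the right one. *)
Lemma insert_cuts x phi w :
  insert x (cuts phi) w =
    cuts (fun u v => insert x (phi^~ v) u) w
    + cuts (fun u v => insert x (phi u) v) w.
Proof.
rewrite /insert (eq_cuts (fun u v _ => cuts_catl phi x u v)) cutsD.
by rewrite !cutsA addrC; congr (_ + _); rewrite -cutsA.
Qed.

(* The sum of f over all the words that permute l. *)
Fixpoint wsum l f := if l is x :: l' then wsum l' (insert x f) else f [::].

(** With P taken to be [gtn m], weights need comparing only on words whose letters are below m. *)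
Lemma eq_wsum P l f g : all P l ->
  (forall w, all P w -> f w = g w) -> wsum l f = wsum l g.
Proof.
elim: l f g => [|x l IHl] f g /=; first by move=> _ eq_f; apply: eq_f.
case/andP=> Px Pl eq_f; apply: IHl => // w Pw; apply: eq_cuts => u v eq_w.
by apply: eq_f; move: Pw; rewrite -eq_w !all_cat /= Px.
Qed.

Lemma wsumD l f g : wsum l (fun w => f w + g w) = wsum l f + wsum l g.
Proof.
elim: l f g => //= x l IHl f g; rewrite -IHl.
by apply: (@eq_wsum predT); rewrite ?all_predT // => w _; apply: cutsD.
Qed.

Lemma wsumZ l a f : wsum l (fun w => a * f w) = a * wsum l f.
Proof.
elim: l f => //= x l IHl f; rewrite -IHl.
by apply: (@eq_wsum predT); rewrite ?all_predT // => w _; apply: cutsZ.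
Qed.

(* Over lists without repetition this is the sum of F B * G C over the ordered
   pairs of complementary sublists B, C of l. *)
Fixpoint conv f g l : R :=
  if l is x :: l' then
    conv (fun s => f (x :: s)) g l' + conv f (fun s => g (x :: s)) l'
  else f [::] * g [::].

Lemma eq_conv P f f' g g' l : all P l ->
  (forall s, all P s -> f s = f' s) -> (forall s, all P s -> g s = g' s) ->
  conv f g l = conv f' g' l.
Proof.
elim: l f f' g g' => [|x l IHl] f f' g g' /=; first by move=> _ -> // ->.
case/andP=> Px Pl eq_f eq_g; congr (_ + _); apply: IHl => // s Ps.
  by apply: eq_f; rewrite /= Px.
by apply: eq_g; rewrite /= Px.
Qed.

Lemma convDl f f' g l :
  conv (fun s => f s + f' s) g l = conv f g l + conv f' g l.
Proof.
elim: l f f' g => [|x l IHl] f f' g /=; first exact: mulrDl.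
by rewrite !IHl addrACA.
Qed.

Lemma convDr f g g' l :
  conv f (fun s => g s + g' s) l = conv f g l + conv f g' l.
Proof.
elim: l f g g' => [|x l IHl] f g g' /=; first exact: mulrDr.
by rewrite !IHl addrACA.
Qed.

Lemma convZl a f g l : conv (fun s => a * f s) g l = a * conv f g l.
Proof.
elim: l f g => [|x l IHl] f g /=; first by rewrite mulrA.
by rewrite !IHl mulrDr.
Qed.

Lemma convZr a f g l : conv f (fun s => a * g s) l = a * conv f g l.
Proof.
elim: l f g => [|x l IHl] f g /=; first by rewrite mulrCA.
by rewrite !IHl mulrDr.
Qed.

Lemma convA f g h l : conv f (conv g h) l = conv (conv f g) h l.
Proof.
elim: l f g h => [|x l IHl] f g h /=; first exact: mulrA.
by rewrite convDr convDl !IHl addrA.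
Qed.

Lemma conv0 f l : conv f (fun _ => 0) l = 0.
Proof. by elim: l f => [|x l IHl] f /=; rewrite ?mulr0 // !IHl addr0. Qed.

Definition isnil l : R := (nilp l)%:R.

Lemma conv_isnil f l : conv f isnil l = f l.
Proof.
elim: l f => [|x l IHl] f /=; first exact: mulr1.
by rewrite IHl conv0 addr0.
Qed.

Lemma cuts_isnilr f w : cuts (fun u v => f u * isnil v) w = f w.
Proof.
elim: w f => [|x w IHw] f /=; first exact: mulr1.
by rewrite mulr0 add0r (IHw (fun u => f (x :: u))).
Qed.

Lemma cuts_isnill f w : cuts (fun u v => isnil u * f v) w = f w.
Proof.
case: w => [|x w] /=; first exact: mul1r.
rewrite mul1r -[RHS]addr0; congr (_ + _).
exact: etrans (cutsZ 0 (fun _ => f) w) (mul0r _).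
Qed.

Lemma wsum_isnil l : wsum l isnil = isnil l.
Proof.
case: l => //= x l; rewrite /isnil -[RHS](mul0r (wsum l isnil)) -wsumZ.
apply: (@eq_wsum predT); rewrite ?all_predT // => w _.
rewrite -[RHS]/(0 * isnil w) mul0r.
transitivity (cuts (fun _ _ => 0 * 0) w); last by rewrite cutsZ mul0r.
by apply: eq_cuts => u v _; rewrite mul0r; case: u.
Qed.

(** Cutting an arrangement of l amounts to splitting l in two and arranging each part. In the
    induction, the two terms of [insert_cuts] match the two terms of [conv]. *)
Lemma wsum_cuts f g l :
  wsum l (cuts (fun u v => f u * g v)) = conv (wsum^~ f) (wsum^~ g) l.
Proof.
elim: l f g => [|x l IHl] f g //=; rewrite -!IHl -wsumD.
apply: (@eq_wsum predT); rewrite ?all_predT // => w _.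
rewrite insert_cuts; congr (_ + _); apply: eq_cuts => u v _.
  by rewrite mulrC -cutsZ; apply: eq_cuts => u1 u2 _; rewrite mulrC.
by rewrite -cutsZ.
Qed.

End Deconcatenation.

(** * Weights of words and insertion of a largest letter *)

Section Weights.
Variables (R : comNzRingType) (x q : R).
Implicit Types (a m : nat) (u v w l : seq nat).

(* The weight of w read after the letter a, which is itself the bottom of a
   descent if b holds. *)
Fixpoint wt_after (b : bool) a w : R :=
  if w is c :: w' then
    if (c < a)%N then x * q ^+ b * wt_after true c w' else wt_after false c w'
  else 1.

Definition wt w : R := if w is a :: w' then wt_after false a w' else 1.

(* The weight of w preceded by an infinite letter, that descent not counted;
   the empty word is excluded. *)
Definition wt_down w : R := if w is a :: w' then wt_after true a w' else 0.

Lemma wt_after_cat_max b a m u v : all (gtn m) (a :: u) ->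
  wt_after b a (u ++ m :: v) = wt_after b a u * wt_after false m v.
Proof.
elim: u b a => [|c u IHu] b a /= /andP[lt_am ltum].
  by rewrite ltnNge ltnW // mul1r.
by case: ifP => _; rewrite IHu // mulrA.
Qed.

Lemma wt_after_max b m v : all (gtn m) v ->
  wt_after b m v = isnil R v + x * q ^+ b * wt_down v.
Proof.
case: v => [|c v]; rewrite /isnil /= ?mulr0 ?addr0 // => /andP[-> _].
by rewrite add0r.
Qed.

(** Here m is never the bottom of a descent, so a descent from m to v brings x without q. *)
Lemma wt_cat_max m u v : all (gtn m) (u ++ v) ->
  wt (u ++ m :: v) = wt u * (isnil R v + x * wt_down v).
Proof.
rewrite all_cat => /andP[ltum ltvm].
have := wt_after_max false ltvm; rewrite mulr1 => <-.
by case: u ltum => [|a u] ltum; rewrite /= ?mul1r ?wt_after_cat_max.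
Qed.

(** The infinite letter makes m the bottom of a descent exactly when u is empty; only then does a
    descent from m complete a 321 and bring q. *)
Lemma wt_down_cat_max m u v : all (gtn m) (u ++ v) ->
  wt_down (u ++ m :: v) = wt_down u * (isnil R v + x * wt_down v)
    + isnil R u * (isnil R v + x * q * wt_down v).
Proof.
rewrite all_cat => /andP[ltum ltvm].
have := wt_after_max false ltvm; have := wt_after_max true ltvm.
rewrite mulr1 => <- <-.
case: u ltum => [|a u] ltum; rewrite /isnil /=.
  by rewrite mul0r add0r mul1r.
by rewrite wt_after_cat_max // mul0r addr0.
Qed.

(* Weighted splittings of l into k + 1 words, the last k of which are nonempty
   and have an infinite letter on their left. *)
Fixpoint forest k : seq nat -> R :=
  if k is j.+1 then conv (forest j) (fun l => wsum l wt_down)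
  else fun l => wsum l wt.

Lemma wsum_wt_max m l : all (gtn m) l ->
  wsum (m :: l) wt = forest 0 l + x * forest 1 l.
Proof.
move=> ltlm /=; rewrite -[in RHS]wsum_cuts -wsumZ -wsumD.
apply: (eq_wsum ltlm) => w ltwm.
rewrite -{1}(cuts_isnilr wt) -cutsZ -cutsD; apply: eq_cuts => u v eq_w.
by rewrite wt_cat_max ?eq_w // mulrDr [in RHS]mulrCA.
Qed.

(** The terms 1, 1, q x and x come from the factors around m: both empty, only the right one, only
    the left one, neither. *)
Lemma wsum_wt_down_max m l (G := fun l => wsum l wt_down) : all (gtn m) l ->
  wsum (m :: l) wt_down = isnil R l + (1 + q * x) * G l + x * conv G G l.
Proof.
move=> ltlm; rewrite /= -wsum_cuts -!wsumZ -{1}wsum_isnil -!wsumD.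
apply: (eq_wsum ltlm) => w ltwm.
(* A term in a single word becomes a sum over cuts with an empty side, so that the two sides compare
   cut by cut. *)
rewrite mulrDl mul1r -{1}(cuts_isnilr (@isnil R nat)) -{1}(cuts_isnilr wt_down).
rewrite -{1}(cuts_isnill wt_down) -!cutsZ -!cutsD; apply: eq_cuts => u v eq_w.
by rewrite wt_down_cat_max ?eq_w //; ring.
Qed.

(** By the Leibniz rule built into [conv], m goes into the last word or into one of the earlier
    words, where the induction hypothesis applies. A valley removes a word and a peak adds one. *)
Lemma forest_max k m l : all (gtn m) l ->
  forest k (m :: l) = k%:R * forest k.-1 l
    + (1 + k%:R * (1 + q * x)) * forest k l + x * k.+1%:R * forest k.+1 l.
Proof.
elim: k => [|k IHk] in l *; move=> ltlm.
  by rewrite [LHS]wsum_wt_max //; ring.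
set G := fun l => wsum l wt_down.
rewrite -[LHS]/(conv (fun s => forest k (m :: s)) G l
                + conv (forest k) (fun s => G (m :: s)) l).
rewrite (eq_conv ltlm IHk (fun s _ => erefl)).
rewrite (eq_conv ltlm (fun s _ => erefl) (@wsum_wt_down_max m)) -/G.
rewrite !convDl !convDr !convZl !convZr conv_isnil convA.
(* For k = 0 the predecessor is a default value, but the factor k vanishes. *)
have -> : k%:R * conv (forest k.-1) G l = k%:R * forest k l.
  by case: k {IHk} => //; rewrite !mul0r.
rewrite /= -/G !mulrS; ring.
Qed.

End Weights.

(** * Permutations as words, built by inserting the largest value *)

Section Permutations.
Variable n : nat.
Implicit Type s : 'S_n.

Lemma size_oneline s : size (oneline s) = n.
Proof. by rewrite size_map size_enum_ord. Qed.

Lemma nth_oneline s (i : 'I_n) : nth 0%N (oneline s) i = s i.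
Proof. by rewrite (nth_map i) ?size_enum_ord // nth_ord_enum. Qed.

End Permutations.

Lemma oneline_lift_perm n (i : 'I_n.+1) (s : 'S_n) :
  oneline (lift_perm i ord_max s) =
    take i (oneline s) ++ n :: drop i (oneline s).
Proof.
have le_in : (i <= n)%N by rewrite -ltnS.
have szt : size (take i (oneline s)) = i by rewrite size_takel ?size_oneline.
apply: (@eq_from_nth _ 0%N) => [|j].
  by rewrite size_cat /= szt size_drop !size_oneline addnS subnKC.
rewrite size_oneline => lt_jn; rewrite -[j]/(val (Ordinal lt_jn)).
case: (unliftP i (Ordinal lt_jn)) => [k|] ->; rewrite nth_oneline nth_cat szt.
  rewrite lift_perm_lift lift_max /= /bump; case: (leqP i k) => [le_ik | lt_ki].
    by rewrite add1n ltnNge leqW // subSn //= nth_drop subnKC // nth_oneline.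
  by rewrite add0n lt_ki nth_take // nth_oneline.
by rewrite lift_perm_id ltnn subnn.
Qed.

Lemma lift_perm_bij n :
  bijective (fun p : 'I_n.+1 * 'S_n => lift_perm p.1 ord_max p.2).
Proof.
apply: inj_card_bij => [[i s] [j t] /= eq_st|]; last first.
  by rewrite card_prod card_ord !card_Sn factS.
(* The position of the largest value determines i. *)
have eq_ij : i = j.
  apply: (@perm_inj _ (lift_perm i ord_max s)).
  by rewrite {2}eq_st !lift_perm_id.
rewrite -{j}eq_ij in eq_st *; congr (_, _); apply/permP => k.
by apply: (@lift_inj _ ord_max); rewrite -!(lift_perm_lift i) eq_st.
Qed.

(** * From sums over permutations to sums over words *)

Section Enumeration.
Variable R : comNzRingType.

Lemma cutsE (T : Type) (phi : seq T -> seq T -> R) w :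
  cuts phi w = \sum_(i < (size w).+1) phi (take i w) (drop i w).
Proof.
elim: w phi => [|x w IHw] phi /=; first by rewrite big_ord1.
by rewrite big_ord_recl IHw.
Qed.

(** The list is reversed because [wsum] inserts its head last, and the largest value must come last
    to match [lift_perm_bij]. *)
Lemma sum_oneline n (f : seq nat -> R) :
  \sum_(s : 'S_n) f (oneline s) = wsum (rev (iota 0 n)) f.
Proof.
elim: n f => [|n IHn] f.
  rewrite (eq_bigr (fun _ => f [::])) => [|s _]; last first.
    by congr (f _); apply: size0nil; rewrite size_oneline.
  by rewrite sumr_const card_Sn mulr1n.
rewrite -addn1 iotaD rev_cat /= -IHn addn1 add0n.
rewrite (reindex _ (onW_bij _ (lift_perm_bij n))) /=.
rewrite -(pair_big predT predT
  (fun i s => f (oneline (lift_perm i ord_max s)))) /=.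
rewrite exchange_big; apply: eq_bigr => s _ /=.
rewrite /insert cutsE size_oneline; apply: eq_bigr => i _.
by rewrite oneline_lift_perm.
Qed.

Lemma exp_card (x : R) n (P : pred 'I_n) :
  x ^+ #|[set i | P i]| = \prod_(i < n) (if P i then x else 1).
Proof. by rewrite -big_mkcond prodr_const cardsE. Qed.

(** The separate power of q is the 321 that would use the letter before a. *)
Lemma wt_afterE (x q : R) b a w (v := nth 0%N (a :: w)) :
  wt_after x q b a w =
    q ^+ [&& b, (0 < size w)%N & (v 1 < v 0)%N] *
    ((\prod_(i < size w) (if (v i.+1 < v i)%N then x else 1)) *
     \prod_(i < (size w).-1)
       (if (v i.+1 < v i)%N && (v i.+2 < v i.+1)%N then q else 1)).
Proof.
rewrite {}/v; elim: w b a => [|c w IHw] b a /=.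
  by rewrite !big_ord0 andbF !mulr1.
rewrite big_ord_recl /= !IHw.
(* The first triple, starting at a, is split off: it is the separate power of q in the induction
   hypothesis. *)
have -> : \prod_(i < size w) (if (nth 0 (c :: w) i < nth 0 (a :: c :: w) i)%N &&
     (nth 0 w i < nth 0 (c :: w) i)%N then q else 1) =
  q ^+ [&& (c < a)%N, (0 < size w)%N & (nth 0 (c :: w) 1 < c)%N] *
  \prod_(i < (size w).-1) (if (nth 0 w i < nth 0 (c :: w) i)%N &&
     (nth 0 w i.+1 < nth 0 w i)%N then q else 1).
  case: (size w) => [|k]; first by rewrite !big_ord0 !andbF mulr1.
  by rewrite big_ord_recl /=; case: ifP.
by case: ifP => _; rewrite ?andbT ?andbF /=; ring.
Qed.

Lemma wt_oneline (x q : R) n (s : 'S_n) :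
  wt x q (oneline s) = x ^+ des s * q ^+ occ321 s.
Proof.
rewrite /des /occ321 !exp_card; move: (oneline s) (size_oneline s) => w <- {s}.
case: w => [|a w] /=; first by rewrite !big_ord0 mulr1.
by rewrite wt_afterE mul1r.
Qed.

End Enumeration.

Theorem corollary4 (R : comNzRingType) (x q : R) :
  calC {| par_a := 1; par_b := 1; par_c := 1; par_d := 1; par_f := 1;
          par_g := 1; par_h := 1; par_l := 1; par_p := x; par_r := 1;
          par_s := q * x; par_t := 1; par_u := 1; par_w := 1 |}
  =1 (fun n : nat => \sum_(sigma : 'S_n) x ^+ des sigma * q ^+ occ321 sigma).
Proof.
have qint1 n : qint n 1 1 = n%:R :> R.
  rewrite /qint (eq_bigr (fun=> 1)) => [|i _]; last by rewrite !expr1n mulr1.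
  by rewrite sumr_const card_ord.
move=> n; rewrite -(eq_bigr _ (fun s _ => wt_oneline x q s)) sum_oneline /=.
pose K k j := forest x q k (rev (iota 0 j)).
have KS k j : K k j.+1 = k%:R * K k.-1 j
    + (1 + k%:R * (1 + q * x)) * K k j + x * k.+1%:R * K k.+1 j.
  rewrite /K -addn1 iotaD rev_cat /= forest_max //.
  by apply/allP => i; rewrite mem_rev mem_iota.
(* The factorization of be_{k+1} = x (k+1)^2 dictated by the outer coefficients of [KS]. *)
pose b k : R := x * k.+1%:R; pose c k : R := k.+1%:R.
apply: (@jfrac_tridiagonal _ _ _ b c K) => [k|k|j|k j]; rewrite /b /c.
- by rewrite qint1; ring.
(* With no value to distribute, no word can be nonempty, which forces k = 0. *)
- by case: k => //= k; rewrite /K /= mulr0.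
- by rewrite KS qint1 expr1n; ring.
- by rewrite KS qint1 expr1n; ring.
Qed.
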